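(* Let $(\mathfrak J,B)$ be a finite-dimensional pseudo-Euclidean Jacobi-Jordan algebra over a field $\mathbb K$ of characteristic $0$. The sequence $$0\longrightarrow \mathrm{Der}_a(\mathfrak J,B)\xrightarrow{\ i\ }\mathrm{Der}(\mathfrak J)\xrightarrow{\ \nu\ }F(\mathfrak J)\xrightarrow{\ \bar\mu\ }{}_zH^3_s(\mathfrak J,\mathbb K)$$ is exact, where $i(D)=D$ for all $D\in \mathrm{Der}_a(\mathfrak J,B)$, $\nu(D)(x,y)=B(D(x),y)+B(x,D(y))$ for $D\in\mathrm{Der}(\mathfrak J)$, and $\bar\mu(\varphi)$ is the cohomology class of the trilinear form $\mu(\varphi)(x,y,z)=\varphi(xy,z)$ for $\varphi\in F(\mathfrak J)$.
   Context: A Jacobi-Jordan algebra is a vector space $\mathfrak J$ with a bilinear product $(x,y)\mapsto xy$ such that $xy=yx$ and $x(yz)+y(zx)+z(xy)=0$ for all $x,y,z$. It is pseudo-Euclidean if it is endowed with a nondegenerate symmetric bilinear form $B$ that is associative (invariant): $B(xy,z)=B(x,yz)$ for all $x,y,z$. $F(\mathfrak J)$ is the vector space of all invariant symmetric bilinear forms $\varphi$ on $\mathfrak J$ (i.e. $\varphi(xy,z)=\varphi(x,yz)$). $\mathrm{Der}(\mathfrak J)$ is the space of derivations ($D$ linear, $D(xy)=D(x)y+xD(y)$), and $\mathrm{Der}_a(\mathfrak J,B)$ is the subspace of derivations with $B(D(x),y)=-B(x,D(y))$ for all $x,y$. Cohomology with values in the trivial module $\mathbb K$: ${}_zZ^3_s(\mathfrak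 J,\mathbb K)$ is the space of symmetric trilinear forms $c$ on $\mathfrak J$ with $\sum_{1\le i<j\le4}c(x_ix_j,x_k,x_l)=0$ for all $x_1,\dots,x_4$, where $\{k<l\}=\{1,2,3,4\}\setminus\{i,j\}$; ${}_zB^3(\mathfrak J,\mathbb K)$ is the space of trilinear forms $\delta^2c(x,y,z)=-\big(c(xy,z)+c(xz,y)+c(yz,x)\big)$ with $c$ a skew-symmetric bilinear form on $\mathfrak J$; and ${}_zH^3_s(\mathfrak J,\mathbb K)={}_zZ^3_s(\mathfrak J,\mathbb K)/{}_zB^3(\mathfrak J,\mathbb K)$. (It is known that $\nu(D)\in F(\mathfrak J)$ and $\mu(\varphi)\in{}_zZ^3_s(\mathfrak J,\mathbb K)$, so the maps are well defined.) *)

(* Defs.v *)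
(* MathComp, with mathcomp.classical.boolp for predicates defined by arbitrary
   propositions.                                                               *)
From HB Require Import structures.
From mathcomp Require Import all_boot all_algebra ring.
From mathcomp Require Import boolp.

Set Implicit Arguments.
Unset Strict Implicit.
Unset Printing Implicit Defensive.

Import GRing.Theory.

Local Open Scope ring_scope.
Local Open Scope quotient_scope.

Section Subspace.
Variables (K : fieldType) (V : lmodType K) (W : submodClosed V).

Record subspace : Type := MkSubspace { subval : V; _ : subval \in W }.

HB.instance Definition _ := [isSub for subval].
HB.instance Definition _ := [Choice of subspace by <:].
HB.instance Definition _ := [SubChoice_isSubLmodule of subspace by <:].

End Subspace.

(* The quotient of a module by a submodule: the library's additive quotient,
   with the induced scaling.                                                   *)
Section QuotientModule.
Variables (K : fieldType) (V : lmodType K) (W : submodClosed V).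

Definition submod_zmod : zmodClosed V :=
  HB.pack (GRing.SubmodClosed.sort W)
    (@GRing.isZmodClosed.Build V (GRing.SubmodClosed.sort W)
      (GRing.submod_closedB (submodClosedP W))).

Definition lquot : Type := Quotient.quot submod_zmod.

HB.instance Definition _ := GRing.Zmodule.on lquot.
HB.instance Definition _ := EqQuotient.on lquot.

Definition lquot_scale (a : K) (q : lquot) : lquot := \pi_lquot (a *: repr q).

Lemma pi_lquotE (u v : V) : (\pi_lquot u = \pi_lquot v) <-> (u - v \in W).
Proof.
have -> : (u - v \in W) = (\pi_lquot u == \pi_lquot v).
  exact: (@Quotient.idealrBE _ submod_zmod u v).
by split=> /eqP.
Qed.

Lemma pi_lquotD (u v : V) :
  \pi_lquot (u + v) = \pi_lquot u + \pi_lquot v.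
Proof. exact: (raddfD (\pi_(Quotient.quot submod_zmod))). Qed.

Lemma lquot_scale_pi a (v : V) :
  lquot_scale a (\pi_lquot v) = \pi_lquot (a *: v).
Proof.
apply/pi_lquotE; rewrite -scalerBr rpredZ //.
by apply/pi_lquotE; rewrite reprK.
Qed.

Lemma lquot_scaleA a b q :
  lquot_scale a (lquot_scale b q) = lquot_scale (a * b) q.
Proof. by rewrite -[q]reprK !lquot_scale_pi reprK scalerA. Qed.

Lemma lquot_scale1 : left_id 1 lquot_scale.
Proof. by move=> q; rewrite -[q]reprK lquot_scale_pi scale1r. Qed.

Lemma lquot_scaleDr : right_distributive lquot_scale +%R.
Proof.
move=> a p q; rewrite -[p]reprK -[q]reprK -pi_lquotD !lquot_scale_pi.
by rewrite scalerDr pi_lquotD.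
Qed.

Lemma lquot_scaleDl q : {morph lquot_scale^~ q : a b / a + b}.
Proof.
by move=> a b; rewrite -[q]reprK !lquot_scale_pi scalerDl pi_lquotD.
Qed.

HB.instance Definition _ := GRing.Zmodule_isLmodule.Build K lquot
  lquot_scaleA lquot_scale1 lquot_scaleDr lquot_scaleDl.

Lemma pi_lquot_linear : linear (\pi_lquot : V -> lquot).
Proof. by move=> a u v; rewrite pi_lquotD -lquot_scale_pi. Qed.

Definition lclass (v : V) : lquot := \pi_lquot v.
HB.instance Definition _ := GRing.isLinear.Build K V lquot _ lclass
  pi_lquot_linear.

End QuotientModule.

Section QuotientOfSubspaces.
Variables (K : fieldType) (V : lmodType K) (Z B : submodClosed V).

Definition sub_in : {pred subspace Z} := [pred v | val v \in B].

Lemma sub_in_closed : submod_closed sub_in.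
Proof.
split=> [|a u v]; rewrite !inE ?rpred0 // => uB vB.
by rewrite linearP rpredD ?rpredZ.
Qed.

HB.instance Definition _ := GRing.isSubmodClosed.Build K (subspace Z) sub_in
  sub_in_closed.

(* This is Z / B when B is contained in Z (see B3_subset_Z3s for the use made
   of it below), and Z / (Z :&: B) in general.                                 *)
Definition subquotient : lmodType K := lquot sub_in.

End QuotientOfSubspaces.

Arguments sub_in {K V} Z B.

Definition exact_at (K : fieldType) (U V W : lmodType K)
    (f : {linear U -> V}) (g : {linear V -> W}) : Prop :=
  forall v : V, g v = 0 <-> exists u : U, f u = v.

HB.mixin Record isJacobiJordan (K : fieldType) J of Vector K J := {
  jjmul : {bilinear J -> J -> J};
  jjmulC : forall x y : J, jjmul x y = jjmul y x;
  jj_jacobi : forall x y z : J,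
    jjmul x (jjmul y z) + jjmul y (jjmul z x) + jjmul z (jjmul x y) = 0
}.

#[short(type="jjAlgType")]
HB.structure Definition JacobiJordan (K : fieldType) :=
  {J of isJacobiJordan K J & Vector K J}.

Notation "x ** y" := (jjmul x y) (at level 40, left associativity) : ring_scope.

(* Bilinear and trilinear forms, curried. The named types keep the instances
   on iterated 'Hom spaces folded, without which unification is very slow.     *)
Definition form2 (K : fieldType) (J : vectType K) : Type :=
  'Hom(J, 'Hom(J, K^o)).
HB.instance Definition _ (K : fieldType) (J : vectType K) :=
  Vector.on (form2 J).

Definition form3 (K : fieldType) (J : vectType K) : Type := 'Hom(J, form2 J).
HB.instance Definition _ (K : fieldType) (J : vectType K) :=
  Vector.on (form3 J).

(* lfun2 curries a map U -> V -> W that is linear in each argument.            *)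
Definition lfun2 (K : fieldType) (U V W : vectType K) (f : U -> V -> W) :
  'Hom(U, 'Hom(V, W)) := linfun (fun u => linfun (f u)).

Lemma lfun2E (K : fieldType) (U V W : vectType K) (f : U -> V -> W) :
    (forall u, linear (f u)) -> (forall v, linear (f^~ v)) ->
  forall u v, lfun2 f u v = f u v.
Proof.
move=> fr fl u v.
have E1 w : linfun (f w) =1 f w.
  pose L := GRing.isLinear.Build K V W _ (f w) (fr w).
  pose F : {linear V -> W} := HB.pack (f w) L.
  exact: (lfunE F).
have lin2 : linear (fun w => linfun (f w)).
  move=> a w w'; apply/lfunP=> z.
  by rewrite !lfunE /= !lfunE /= !E1 fl.
pose L := GRing.isLinear.Build K U 'Hom(V, W) _ (fun w => linfun (f w)) lin2.
pose F : {linear U -> 'Hom(V, W)} := HB.pack (fun w => linfun (f w)) L.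
by rewrite /lfun2 (lfunE F) /= E1.
Qed.

Lemma lfunP_lin (K : fieldType) (U V : vectType K) a (f g : 'Hom(U, V)) u :
  (a *: f + g) u = a *: f u + g u.
Proof. by rewrite lfunE /= lfunE. Qed.

Section Spaces.
Variables (K : fieldType) (J : jjAlgType K).
Local Notation form2 := (form2 J).
Local Notation form3 := (form3 J).

Definition derivation (D : 'End(J)) : Prop :=
  forall x y, D (x ** y) = D x ** y + x ** D y.

Definition der_pred : {pred 'End(J)} := [pred D | `[< derivation D >]].

Lemma derP (D : 'End(J)) : reflect (derivation D) (D \in der_pred).
Proof. exact: asboolP. Qed.

Lemma der_closed : submod_closed der_pred.
Proof.
split=> [|a D E].
  by apply/derP=> x y; rewrite !lfunE /= linear0l linear0r addr0.
move=> /derP HD /derP HE; apply/derP=> x y.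
rewrite !lfunE /= !lfunE /= HD HE linearDl linearDr linearZl_LR linearZr_LR.
by rewrite scalerDr /= addrACA.
Qed.

HB.instance Definition _ := GRing.isSubmodClosed.Build K 'End(J) der_pred
  der_closed.

Definition Der : lmodType K := subspace der_pred.

Definition dera_pred (B : form2) : {pred 'End(J)} :=
  [pred D | `[< derivation D /\ forall x y, B (D x) y = - B x (D y) >]].

Lemma deraP (B : form2) (D : 'End(J)) :
  reflect (derivation D /\ forall x y, B (D x) y = - B x (D y))
          (D \in dera_pred B).
Proof. exact: asboolP. Qed.

Lemma dera_closed B : submod_closed (dera_pred B).
Proof.
split=> [|a D E].
  apply/deraP; split; first by apply/derP/(proj1 der_closed).
  by move=> x y; rewrite !lfunE /= !linear0 lfunE /=.
move=> /deraP[HD sD] /deraP[HE sE]; apply/deraP; split.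
  by apply/derP/(proj2 der_closed); apply/derP.
move=> x y; rewrite !lfunP_lin linearP lfunP_lin linearP /=.
by rewrite sD sE opprD scalerN.
Qed.

HB.instance Definition _ B := GRing.isSubmodClosed.Build K 'End(J) (dera_pred B)
  (dera_closed B).

Lemma form2_0E x y : (0 : form2) x y = 0.
Proof. by rewrite (zero_lfunE _ x) (zero_lfunE _ y). Qed.

Lemma form2_linE a (p q : form2) x y :
  (a *: p + q) x y = a *: p x y + q x y.
Proof. by rewrite (lfunP_lin a p q x) lfunP_lin. Qed.

Lemma form2_linearl (p : form2) a x x' y :
  p (a *: x + x') y = a *: p x y + p x' y.
Proof. by rewrite (linearP p) (lfunP_lin a (p x) (p x') y). Qed.

Lemma form3_0E x y z : (0 : form3) x y z = 0.
Proof. by rewrite (zero_lfunE _ x) form2_0E. Qed.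

Lemma form3_linE a (p q : form3) x y z :
  (a *: p + q) x y z = a *: p x y z + q x y z.
Proof. by rewrite (lfunP_lin a p q x) form2_linE. Qed.

Definition invariant_form (phi : form2) : Prop :=
  forall x y z, phi (x ** y) z = phi x (y ** z).

Definition symmetric_form (phi : form2) : Prop :=
  forall x y, phi x y = phi y x.

Definition skew_form (c : form2) : Prop :=
  forall x y, c x y = - c y x.

Definition nondegenerate_form (B : form2) : Prop :=
  forall x, (forall y, B x y = 0) -> x = 0.

Definition invForms_pred : {pred form2} :=
  [pred phi | `[< symmetric_form phi /\ invariant_form phi >]].

Lemma invFormsP (phi : form2) :
  reflect (symmetric_form phi /\ invariant_form phi) (phi \in invForms_pred).
Proof. exact: asboolP. Qed.

Lemma invForms_closed : submod_closed invForms_pred.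
Proof.
split=> [|a p q].
  by apply/invFormsP; split=> [x y|x y z]; rewrite !form2_0E.
move=> /invFormsP[sp ip] /invFormsP[sq iq]; apply/invFormsP.
split=> [x y|x y z]; rewrite !form2_linE.
  by rewrite sp sq.
by rewrite ip iq.
Qed.

HB.instance Definition _ := GRing.isSubmodClosed.Build K _ invForms_pred
  invForms_closed.

Definition invForms : lmodType K := subspace invForms_pred.

Definition symmetric_form3 (c : form3) : Prop :=
  forall x y z, [/\ c x y z = c y x z, c x y z = c z y x & c x y z = c x z y].

Definition cocycle3 (c : form3) : Prop :=
  forall x1 x2 x3 x4,
    c (x1 ** x2) x3 x4 + c (x1 ** x3) x2 x4 + c (x1 ** x4) x2 x3
    + c (x2 ** x3) x1 x4 + c (x2 ** x4) x1 x3 + c (x3 ** x4) x1 x2 = 0.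

Definition Z3s_pred : {pred form3} :=
  [pred c | `[< symmetric_form3 c /\ cocycle3 c >]].

Lemma Z3sP (c : form3) :
  reflect (symmetric_form3 c /\ cocycle3 c) (c \in Z3s_pred).
Proof. exact: asboolP. Qed.

Lemma Z3s_closed : submod_closed Z3s_pred.
Proof.
split=> [|a p q].
  apply/Z3sP; split=> [x y z|x y z t].
    by split; rewrite !form3_0E.
  by rewrite !form3_0E !addr0.
move=> /Z3sP[sp ip] /Z3sP[sq iq]; apply/Z3sP.
split=> [x y z|x y z t]; rewrite !form3_linE.
  by have [-> -> ->] := sp x y z; have [-> -> ->] := sq x y z.
transitivity (a *: (0 : K^o) + 0); last by rewrite scaler0 addr0.
rewrite -[X in _ = a *: X + _](ip x y z t) -[X in _ = _ + X](iq x y z t).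
rewrite !scalerDr.
by do 5! (rewrite [in RHS]addrACA; congr (_ + _)).
Qed.

HB.instance Definition _ := GRing.isSubmodClosed.Build K _ Z3s_pred Z3s_closed.

Definition coboundary3 (t : form3) : Prop :=
  exists c : form2, skew_form c /\
    forall x y z, t x y z = - (c (x ** y) z + c (x ** z) y + c (y ** z) x).

Definition B3_pred : {pred form3} := [pred t | `[< coboundary3 t >]].

Lemma B3P (t : form3) : reflect (coboundary3 t) (t \in B3_pred).
Proof. exact: asboolP. Qed.

Lemma B3_closed : submod_closed B3_pred.
Proof.
split=> [|a p q].
  apply/B3P; exists 0; split=> [x y|x y z]; rewrite ?form3_0E !form2_0E.
    by rewrite oppr0.
  by rewrite !addr0 oppr0.
move=> /B3P[c [sc cE]] /B3P[d [sd dE]]; apply/B3P.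
exists (a *: c + d); split=> [x y|x y z]; rewrite ?form3_linE !form2_linE.
  by rewrite sc sd opprD scalerN.
rewrite cE dE scalerN -opprD !scalerDr; congr (- _).
by do 2! (rewrite [in LHS]addrACA; congr (_ + _)).
Qed.

HB.instance Definition _ := GRing.isSubmodClosed.Build K _ B3_pred B3_closed.

Lemma B3_subset_Z3s (t : form3) : t \in B3_pred -> t \in Z3s_pred.
Proof.
move=> /B3P[c [sc cE]]; apply/Z3sP; split=> [x y z|x y z t'].
  split; rewrite !cE; congr (- _).
  - by rewrite (jjmulC y x) [LHS]addrAC.
  - rewrite (jjmulC z y) (jjmulC z x) (jjmulC y x) [LHS]addrC.
    by rewrite [X in _ + X]addrC addrA.
  - by rewrite (jjmulC z y) [X in X + _ = _]addrC.
have J3 u v w s : c ((v ** w) ** u) s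
    = - (c ((u ** v) ** w) s + c ((u ** w) ** v) s).
  apply/eqP; rewrite -subr_eq0 opprK -!add_lfunE -!linearD.
  have -> : (v ** w) ** u + ((u ** v) ** w + (u ** w) ** v) = 0.
    rewrite -(jj_jacobi u v w) (jjmulC (v ** w)) (jjmulC (u ** v)).
    by rewrite (jjmulC (u ** w)) (jjmulC u w) [X in _ + X = _]addrC addrA.
  by rewrite linear0 zero_lfunE.
rewrite !cE (J3 x y z) (J3 x y t') (J3 x z t') (J3 y z t').
rewrite (sc (z ** t')) (sc (y ** t')) (sc (y ** z)).
do 11! move: (c _ _).
by rewrite /GRing.regular => *; ring.
Qed.

Definition H3s : lmodType K := subquotient Z3s_pred B3_pred.

(* For B : invForms, the pair (J, B) is a pseudo-Euclidean algebra when this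
   holds, B being symmetric and invariant by construction.                     *)
Definition pseudo_euclidean (B : invForms) : Prop := nondegenerate_form (val B).

Definition Der_a (B : invForms) : lmodType K := subspace (dera_pred (val B)).

Lemma dera_der (B : form2) (D : 'End(J)) :
  D \in dera_pred B -> D \in der_pred.
Proof. by move=> /deraP[HD _]; apply/derP. Qed.

Definition incl_der (B : invForms) (D : Der_a B) : Der :=
  MkSubspace (dera_der (valP D)).

Lemma incl_der_linear B : linear (@incl_der B).
Proof. by move=> a D E; apply/val_inj. Qed.

HB.instance Definition _ B := GRing.isLinear.Build K (Der_a B) Der _
  (@incl_der B) (@incl_der_linear B).

Definition nu_form (B : form2) (D : 'End(J)) : form2 :=
  lfun2 (fun x y => B (D x) y + B x (D y)).

Lemma nu_formE (B : form2) (D : 'End(J)) x y :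
  nu_form B D x y = B (D x) y + B x (D y).
Proof.
rewrite /nu_form lfun2E // => [u a v w|v a u w] /=.
  by rewrite !linearP /= scalerDr addrACA.
by rewrite !linearP /= !lfunP_lin scalerDr addrACA.
Qed.

Lemma nu_form_linear (B : form2) : linear (nu_form B).
Proof.
move=> a D E; apply/lfunP=> x; apply/lfunP=> y.
rewrite (form2_linE a (nu_form B D) (nu_form B E) x y).
rewrite (nu_formE B D) (nu_formE B E) (nu_formE B (a *: D + E)).
rewrite (lfunP_lin a D E x) (lfunP_lin a D E y) form2_linearl (linearP (B x)).
by rewrite scalerDr addrACA.
Qed.

Lemma nu_form_inv (B : invForms) (D : 'End(J)) :
  D \in der_pred -> nu_form (val B) D \in invForms_pred.
Proof.
have /invFormsP[sB iB] := valP B => /derP HD.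
apply/invFormsP; split=> [x y|x y z]; rewrite !nu_formE.
  by rewrite addrC sB [X in _ + X]sB.
rewrite !HD [val B (_ + _)]linearD add_lfunE !iB [val B x (_ + _)]linearD.
by rewrite addrA.
Qed.

Definition nu (B : invForms) (D : Der) : invForms :=
  MkSubspace (nu_form_inv B (valP D)).

Lemma nu_linear B : linear (nu B).
Proof.
move=> a D E; apply: val_inj; exact: (nu_form_linear (val B) a (val D) (val E)).
Qed.

HB.instance Definition _ B := GRing.isLinear.Build K Der invForms _ (nu B)
  (@nu_linear B).

Definition mu_form (phi : form2) : form3 := lfun2 (fun x y => phi (x ** y)).

Lemma mu_formE phi x y z : mu_form phi x y z = phi (x ** y) z.
Proof.
rewrite /mu_form lfun2E // => [u a v w|v a u w] /=.
  by rewrite linearPr linearP.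
by rewrite linearPl linearP.
Qed.

Lemma mu_form_linear : linear mu_form.
Proof.
move=> a p q; apply/lfunP=> x; apply/lfunP=> y; apply/lfunP=> z.
by rewrite form3_linE !mu_formE form2_linE.
Qed.

Lemma mu_form_Z3s (phi : form2) :
  phi \in invForms_pred -> mu_form phi \in Z3s_pred.
Proof.
move=> /invFormsP[sp ip]; apply/Z3sP; split=> [x y z|x y z t].
  rewrite !mu_formE; split.
  - by rewrite jjmulC.
  - by rewrite ip sp jjmulC.
  - by rewrite (jjmulC x y) ip sp.
rewrite !mu_formE.
rewrite (ip _ z t) (ip _ y t) (ip _ y z) (ip _ x t) (ip _ x z) (ip _ x y).
rewrite (sp (y ** z)) (sp (y ** t)) (sp (z ** t)).
have E : phi (x ** y) (z ** t) + phi (x ** z) (y ** t)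
         + phi (x ** t) (y ** z) = 0.
  by rewrite !ip -!linearD (jjmulC y t) jj_jacobi linear0.
rewrite -(addr0 0) -[X in _ = X + _]E -[X in _ = _ + X]E.
do 3! move: (phi _ _).
by rewrite /GRing.regular => *; ring.
Qed.

Definition mu (phi : invForms) : subspace Z3s_pred :=
  MkSubspace (mu_form_Z3s (valP phi)).

Definition mubar (phi : invForms) : H3s :=
  lclass (sub_in Z3s_pred B3_pred) (mu phi).

Lemma mubar_linear : linear mubar.
Proof.
move=> a p q; rewrite /mubar -linearP; congr (lclass _ _).
apply: val_inj; exact: (mu_form_linear a (val p) (val q)).
Qed.

HB.instance Definition _ := GRing.isLinear.Build K invForms H3s _ mubar
  mubar_linear.

End Spaces.

Arguments incl_der {K J} B D.
Arguments nu {K J} B D.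
Arguments mubar {K J} phi.

(* Main.v *)
Require Import Defs.
From mathcomp Require Import all_boot all_algebra.
From mathcomp Require Import ring.

Import GRing.Theory.
Local Open Scope ring_scope.

(** Exactness at Der_a and at Der only unfolds definitions: nu D = 0 says
    precisely that D is skew-adjoint for B. The content is exactness at the
    invariant forms.

    Write b for the bilinear form b(x, y) = B(D x, y) attached to an
    endomorphism D. Since B is invariant and nondegenerate, D is a derivation if
    and only if

      b(xy, z) = b(x, yz) + b(y, xz)   for all x, y, z,

    and nu D is b symmetrized: phi(x, y) = b(x, y) + b(y, x). Giving b with
    symmetrization phi amounts to giving its skew part: b = (phi - c) / 2 with
    c skew. Invariance of phi gives phi(xy, z) = phi(x, yz) = phi(y, xz), so for
    such a b the derivation identity, multiplied by 2, becomes

      phi(xy, z) = - (c(xy, z) + c(xz, y) + c(yz, x)),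

    that is, mu phi is the coboundary of c. So the derivations D with
    nu D = phi correspond to the skew forms c with coboundary mu phi. One
    direction ([nu_coboundary]) takes c = phi - 2 b. The other
    ([coboundary_nu]) divides by 2, which characteristic 0 permits, and recovers
    D from b because a nondegenerate form in finite dimension represents every
    bilinear form ([nondegenerate_represent]). *)

Lemma lclass_eq0 (K : fieldType) (V : lmodType K) (W : submodClosed V) (v : V) :
  lclass W v = 0 <-> v \in W.
Proof.
rewrite -(linear0 (lclass W)) -[v in v \in W]subr0; exact: pi_lquotE.
Qed.

Section Forms.
Variables (K : fieldType) (J : jjAlgType K).
Implicit Types (b c p : form2 J) (B phi : invForms J) (D : 'End(J)).

Lemma mubar_eq0 phi : mubar phi = 0 <-> coboundary3 (mu_form (val phi)).
Proof. by rewrite /mubar lclass_eq0; split=> /B3P. Qed.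

(** The map x |-> B x from J to its dual is injective, hence bijective because
    both spaces have the same dimension; D is b followed by its
    inverse. *)
Lemma nondegenerate_represent p b :
  nondegenerate_form p -> exists D, forall x y, p (D x) y = b x y.
Proof.
move=> ndp.
have ker0 : lker p == 0%VS.
  apply/eqP/vspaceP=> x; rewrite memv_ker memv0.
  apply/eqP/eqP=> [px0|->]; last exact: linear0.
  by apply: ndp => y; rewrite px0 zero_lfunE.
have img : limg p = fullv.
  apply/eqP; rewrite eqEdim subvf /= limg_dim_eq; last first.
    by rewrite (eqP ker0) capv0.
  by rewrite !dimvf /dim /= muln1.
exists (p^-1 \o b)%VF => x y.
by rewrite comp_lfunE limg_lfunVK // img memvf.
Qed.

Lemma nu_coboundary B D :
  derivation D -> coboundary3 (mu_form (nu_form (val B) D)).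
Proof.
have /invFormsP[sB iB] := valP B => derD.
(* For b(x, y) = B (D x) y this is the form phi - 2 b. *)
pose c : form2 J := lfun2 (fun x y => val B x (D y) - val B (D x) y).
have cE x y : c x y = val B x (D y) - val B (D x) y.
  rewrite /c lfun2E // => [u a v w|v a u w] /=.
    by rewrite !linearP scalerDr addrACA.
  by rewrite !linearP /= !lfunP_lin scalerDr scalerN opprD addrACA.
exists c; split=> [x y|x y z].
  by rewrite !cE (sB x) (sB (D x)) opprB.
have BD u v w :
    val B (D (u ** v)) w = val B (D u) (v ** w) + val B (D v) (u ** w).
  by rewrite derD linearD add_lfunE (jjmulC u (D v)) !iB.
rewrite mu_formE nu_formE !cE !BD.
have -> : val B (x ** z) (D y) = val B (D y) (x ** z) by rewrite sB.
have -> : val B (y ** z) (D x) = val B (D x) (y ** z) by rewrite sB.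
have -> : val B (x ** y) (D z) = val B (D z) (x ** y) by rewrite sB.
rewrite (jjmulC z y) (jjmulC y x) (jjmulC z x).
do 3! move: (val B _ _).
by rewrite /GRing.regular => *; ring.
Qed.

Lemma coboundary_nu B phi : (2%:R : K) != 0 -> pseudo_euclidean B ->
    coboundary3 (mu_form (val phi)) ->
  exists2 D, derivation D & nu_form (val B) D = val phi.
Proof.
move=> two0 ndB [c [skc cE]].
have /invFormsP[sB iB] := valP B; have /invFormsP[sp ip] := valP phi.
have [D DE] := nondegenerate_represent _ (2%:R^-1 *: (val phi - c)) ndB.
have bE x y : val B (D x) y = 2%:R^-1 * (val phi x y - c x y).
  by rewrite DE scale_lfunE add_lfunE opp_lfunE scale_lfunE add_lfunE opp_lfunE.
exists D => [x y|]; last first.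
  apply/lfunP=> x; apply/lfunP=> y.
  rewrite nu_formE (sB x) !bE (sp y x) (skc y x).
  move: (val phi x y) (c x y); rewrite /GRing.regular => p q; field.
  exact: two0.
(* By nondegeneracy it suffices to check the derivation identity against z. *)
apply/eqP; rewrite -subr_eq0; apply/eqP/ndB => z.
rewrite linearB linearD (jjmulC x (D y)) add_lfunE opp_lfunE add_lfunE.
rewrite !iB !bE.
have := cE x y z; rewrite mu_formE.
rewrite -(ip x y z) -(ip y x z) (jjmulC y x).
rewrite (skc (x ** z)) (skc (y ** z)).
move: (val phi (x ** y) z) (c (x ** y) z) (c y (x ** z)) (c x (y ** z)).
rewrite /GRing.regular => p q r s ->; ring.
Qed.

End Forms.

Theorem theorem3 (K : fieldType) (charK0 : [pchar K] =i pred0)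
    (J : jjAlgType K) (B : invForms J) (peB : pseudo_euclidean B) :
  [/\ exact_at (\0 : {linear 'rV[K]_0 -> Der_a B}) (incl_der B),
      exact_at (incl_der B) (nu B)
    & exact_at (nu B) mubar].
Proof.
split=> [D|D|phi].
- split=> [D0|[u <-]]; last exact: linear0.
  by exists 0; apply: val_inj; rewrite -[RHS]/(val (incl_der B D)) D0.
- split=> [nu0|[E <-]].
    have DaD : val D \in dera_pred (val B).
      apply/deraP; split; first exact/derP/(valP D).
      move=> x y; apply/eqP; rewrite -addr_eq0 -nu_formE.
      by rewrite -[nu_form _ _]/(val (nu B D)) nu0 form2_0E.
    by exists (MkSubspace DaD); apply: val_inj.
  have /deraP[_ skE] := valP E.
  apply: val_inj; apply/lfunP=> x; apply/lfunP=> y.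
  by rewrite form2_0E nu_formE skE addNr.
- rewrite mubar_eq0; split=> [cob|[D <-]]; last first.
    exact/nu_coboundary/derP/(valP D).
  have two0 : (2%:R : K) != 0 by rewrite (proj1 (pcharf0P K) charK0).
  have [D derD nuD] := coboundary_nu _ _ _ _ two0 peB cob.
  by exists (MkSubspace (introT (derP _) derD)); apply: val_inj.
Qed.
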